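(* Let $D \ge 1$ and let $X$ and $Y$ be independent normally distributed random variables with values in $\mathbb{R}^D$, where $X \sim \mathcal{N}(\mu_X, \Sigma_X)$ and $Y \sim \mathcal{N}(\mu_Y, \Sigma_Y)$. Then $$\mathbb{E}\,\| X - Y \|_2^2 = \| \mu_X - \mu_Y \|_2^2 + \operatorname{tr}(\Sigma_X + \Sigma_Y).$$
   Context: $\mathcal{N}(\mu, \Sigma)$ denotes the multivariate normal distribution on $\mathbb{R}^D$ with mean vector $\mu \in \mathbb{R}^D$ and symmetric positive semi-definite covariance matrix $\Sigma \in \mathbb{R}^{D \times D}$; $\|\cdot\|_2$ is the Euclidean norm and $\operatorname{tr}$ is the matrix trace. *)

(* Defs.v *)
From HB Require Import structures.
From mathcomp Require Import all_boot all_order all_algebra.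
From mathcomp Require Import all_classical all_reals all_analysis.

Set Implicit Arguments.
Unset Strict Implicit.
Unset Printing Implicit Defensive.

Import Order.TTheory GRing.Theory Num.Theory.

Local Open Scope classical_set_scope.
Local Open Scope ring_scope.

Definition measure_matrix_display : measure_display -> measure_display.
Proof. exact. Qed.

(* Matrices carry the product sigma-algebra, i.e. the one generated by the
   entries; on ['cV[R]_D], for [R : realType], this is the Borel sigma-algebra
   of R^D. *)
Section measurable_matrix.
Context {d} {T : measurableType d}.
Variables m n : nat.

Definition matrix_measurable : set (set 'M[T]_(m, n)) :=
  <<s \bigcup_(ij in [set: 'I_m * 'I_n])
        preimage_set_system setT (fun A : 'M[T]_(m, n) => A ij.1 ij.2)
          measurable >>.

Let matrix_set0 : matrix_measurable set0.
Proof. exact: sigma_algebra0. Qed.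

Let matrix_setC A : matrix_measurable A -> matrix_measurable (~` A).
Proof. exact: sigma_algebraC. Qed.

Let matrix_bigcup (F : (set 'M[T]_(m, n))^nat) :
  (forall i, matrix_measurable (F i)) -> matrix_measurable (\bigcup_i F i).
Proof. exact: sigma_algebra_bigcup. Qed.

HB.instance Definition _ := @isMeasurable.Build (measure_matrix_display d)
  'M[T]_(m, n) matrix_measurable matrix_set0 matrix_setC matrix_bigcup.

End measurable_matrix.

(* The norm [`|x|] that the library puts on matrices is the sup norm. *)
Definition norm2 {R : realType} {D : nat} (x : 'cV[R]_D) : R :=
  Num.sqrt (\sum_(i < D) x i ord0 ^+ 2).

Definition sym_psd {R : realType} {D : nat} (S : 'M[R]_D) : Prop :=
  S^T = S /\ forall a : 'cV[R]_D, 0 <= (a^T *m S *m a) ord0 ord0.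

(* The normal law on R with mean [m] and variance [v >= 0].  The degenerate case
   is treated apart because [normal_prob m 0] is the uniform law on [0, 1];
   [normal_prob] takes the standard deviation as its parameter. *)
Definition normal_law1 {R : realType} (m v : R) (B : set R) : \bar R :=
  if v == 0 then \d_m B else normal_prob m (Num.sqrt v) B.

(* [Q] is N(mu, S): for every [a] the image of [Q] by [x |-> <a, x>] is the
   normal law on R with mean <a, mu> and variance <a, S a>.  This covers singular
   [S], for which [Q] has no density. *)
Definition is_normal_law {R : realType} {D : nat} (mu : 'cV[R]_D) (S : 'M[R]_D)
    (Q : probability 'cV[R]_D R) : Prop :=
  forall (a : 'cV[R]_D) (B : set R), measurable B ->
    pushforward Q (fun x : 'cV[R]_D => (a^T *m x) ord0 ord0) B =
    normal_law1 ((a^T *m mu) ord0 ord0) ((a^T *m S *m a) ord0 ord0) B.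

Definition independent_RV {d d1 d2 : measure_display} {T : measurableType d}
    {T1 : measurableType d1} {T2 : measurableType d2} {R : realType}
    (P : probability T R) (X : {RV P >-> T1}) (Y : {RV P >-> T2}) : Prop :=
  forall (A : set T1) (B : set T2), measurable A -> measurable B ->
    P (X @^-1` A `&` Y @^-1` B) = (P (X @^-1` A) * P (Y @^-1` B))%E.

(* Main.v *)
Require Import Defs.
From HB Require Import structures.
From mathcomp Require Import all_boot all_order all_algebra.
From mathcomp Require Import all_classical all_reals all_analysis.
From mathcomp Require Import measurable_realfun ring.

(* The expectation splits coordinatewise, and by independence and Tonelli the
   i-th coordinate contributes the iterated integral of (y - x)^2 against the
   one-dimensional normal laws of Y_i and X_i.  If Z is normal with mean m and
   variance v then E (Z - c)^2 = v + (m - c)^2 for every constant c; applying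
   this twice, first with c = x and then with c = E Y_i, gives the result
   without cross moments, so every integrand is nonnegative.  The formula for
   E (Z - c)^2 reduces to integrating (a x + b)^2 exp (- x^2) over each
   half-line, where an antiderivative is explicit in terms of the primitive of
   exp (- x^2). *)

Set Implicit Arguments.
Unset Strict Implicit.
Unset Printing Implicit Defensive.

Import Order.TTheory GRing.Theory Num.Theory.
Import numFieldNormedType.Exports.
Import gauss_integral_proof.

Local Open Scope classical_set_scope.
Local Open Scope ring_scope.

(** * Integrals of [(a x + b)^2 exp (- x^2)] *)

Section gauss_moments.
Context {R : realType}.
Notation mu := (@lebesgue_measure R).
Implicit Types a b x : R.

(** The limit of the square is known to be [pi / 4]; the square root is continuous and undoes the
    square, since [integral0_gauss] is nonnegative. *)
Lemma cvg_integral0_gauss :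
  @integral0_gauss R x @[x --> +oo] --> Num.sqrt pi / 2.
Proof.
have : Num.sqrt (@integral0_gauss R x ^+ 2) @[x --> +oo] --> Num.sqrt (pi / 4).
  by apply: continuous_cvg; [exact: sqrt_continuous|
    exact: cvg_integral0_gauss_sqr].
rewrite sqrtrM ?pi_ge0// sqrtrV// (_ : 4 = 2 ^+ 2); last by rewrite expr2 -natrM.
rewrite sqrtr_sqr ger0_norm//.
rewrite (_ : (fun _ => Num.sqrt _) = integral0_gauss)//.
by apply/funext => r; rewrite sqrtr_sqr ger0_norm// integral0_gauss_ge0.
Qed.

Lemma integrable_gauss_itv a b : mu.-integrable `[a, b] (EFin \o gauss_fun).
Proof. exact: (integrableS _ _ _ integrableT_gauss). Qed.

Lemma is_derive_integral0_gauss x : 0 < x ->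
  is_derive x 1 (@integral0_gauss R) (gauss_fun x).
Proof.
(* The endpoint [x + 1] only serves to make [x] interior to the interval of integration. *)
move=> x0; have xx1 : x < x + 1 by rewrite ltrDl.
have [dG G'] := continuous_FTC1_closed xx1 (integrable_gauss_itv 0 (x + 1)) x0
  (@continuous_gauss_fun R x).
by apply: DeriveDef => //; rewrite -derive1E.
Qed.

Lemma is_derive_gauss_fun x :
  is_derive x 1 (@gauss_fun R) (- (2 * x) * gauss_fun x).
Proof.
rewrite /gauss_fun; apply: is_derive_eq.
rewrite /GRing.scale /=; ring.
Qed.

(** Squeeze between 0 and [x^-1]: [x^2 <= 1 + x^2 <= exp (x^2)]. *)
Lemma cvg_id_gauss_fun : x * gauss_fun x @[x --> +oo] --> (0 : R).
Proof.
apply: (@squeeze_cvgr _ _ _ _ (cst 0) (fun x => x^-1)).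
- near=> x.
  have x0 : 0 < x by near: x; exact: nbhs_pinfty_gt.
  rewrite mulr_ge0 ?(ltW x0) ?expR_ge0//= /gauss_fun expRN.
  rewrite ler_pdivrMr ?expR_gt0// mulrC ler_pdivlMr//.
  by rewrite -expr2 (le_trans _ (expR_ge1Dx _))// lerDr.
- exact: cvg_cst.
- by apply/gtr0_cvgV0; [exact: nbhs_pinfty_gt | exact: cvg_id].
Unshelve. all: by end_near. Qed.

Lemma continuous_affine_sqr_gauss a b :
  continuous (fun x : R => (a * x + b) ^+ 2 * gauss_fun x).
Proof.
move=> x; apply: cvgM; last exact: continuous_gauss_fun.
by apply: (@cvg_comp _ _ _ (fun x => a * x + b) (fun y => y ^+ 2));
  [apply: cvgD; [exact: mulrl_continuous|exact: cvg_cst]|exact: exprn_continuous].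
Qed.

Lemma integral0y_affine_sqr_gauss a b :
  (\int[mu]_(x in `[0%R, +oo[) ((a * x + b) ^+ 2 * gauss_fun x)%:E =
   (a ^+ 2 * Num.sqrt pi / 4 + a * b + b ^+ 2 * Num.sqrt pi / 2)%:E)%E.
Proof.
(* With [g = gauss_fun], [(x g)' = g - 2 x^2 g] and [g' = - 2 x g]; solving for [x^2 g] and [2 x g]
   in the expanded square gives this antiderivative. *)
pose K x := (a ^+ 2 / 2 + b ^+ 2) * integral0_gauss x -
  (a ^+ 2 / 2 * (x * gauss_fun x) + a * b * gauss_fun x).
have dK x : 0 < x -> is_derive x 1 K ((a * x + b) ^+ 2 * gauss_fun x).
  move=> x0; have := is_derive_integral0_gauss x0; have := is_derive_gauss_fun x.
  by move=> dg dG; apply: is_derive_eq; rewrite /GRing.scale /=; field.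
have K0 : K 0 = - (a * b).
  rewrite /K /integral0_gauss set_itv1 Rintegral_set1 /gauss_fun.
  by rewrite expr0n/= oppr0 expR0; ring.
transitivity ((a ^+ 2 * Num.sqrt pi / 4 + b ^+ 2 * Num.sqrt pi / 2)%:E
    - (K 0)%:E)%E;
  last by rewrite K0 -EFinB; congr EFin; ring.
apply: (@ge0_continuous_FTC2y _ (fun x => (a * x + b) ^+ 2 * gauss_fun x) K).
- by move=> x _; rewrite mulr_ge0 ?sqr_ge0 ?expR_ge0.
- by apply: continuous_subspaceT; exact: continuous_affine_sqr_gauss.
- rewrite (_ : _ + _ = (a ^+ 2 / 2 + b ^+ 2) * (Num.sqrt pi / 2) -
    (a ^+ 2 / 2 * 0 + a * b * 0)); last by field.
  by apply: cvgB; [|apply: cvgD]; apply: cvgMl_tmp;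
    [exact: cvg_integral0_gauss|exact: cvg_id_gauss_fun|exact: cvg_gauss_fun].
- by move=> x x0; have [] := dK _ x0.
(* Since [dK] covers only [0 < x], right continuity of [K] at 0 is shown separately, term by
   term. *)
- apply: cvgB; last first.
    apply: cvg_at_right_filter; apply: cvgD; apply: cvgMl_tmp;
      last exact: continuous_gauss_fun.
    by apply: cvgM; [exact: cvg_id|exact: continuous_gauss_fun].
  apply: cvgMl_tmp; rewrite {2}/integral0_gauss set_itv1 Rintegral_set1.
  apply: cvg_at_right_filter.
  exact: (@parameterized_integral_cvg_left _ _ 1 _ ltr01
    (integrable_gauss_itv _ _)).
- move=> x; rewrite in_itv/= andbT => x0; rewrite derive1E.
  by have [_] := dK _ x0.
Qed.

(** Reflection turns the negative half-line into the positive one with [- a] for [a], so the terms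
    in [a * b] cancel. *)
Lemma integralT_affine_sqr_gauss a b :
  (\int[mu]_x ((a * x + b) ^+ 2 * gauss_fun x)%:E =
   (a ^+ 2 * Num.sqrt pi / 2 + b ^+ 2 * Num.sqrt pi)%:E)%E.
Proof.
pose f x := (a * x + b) ^+ 2 * gauss_fun x.
rewrite -[LHS]/(\int[mu]_x (f x)%:E)%E.
have cf : continuous f := @continuous_affine_sqr_gauss a b.
have mf : measurable_fun [set: R] f by exact: continuous_measurable_fun.
have f0 x : 0 <= f x by rewrite mulr_ge0 ?sqr_ge0 ?expR_ge0.
rewrite -(setUv (`[0, +oo[ : set R)) ge0_integral_setU//=; last 4 first.
  exact: measurableC.
  by apply/measurable_EFinP; rewrite setUv.
  by move=> x _; rewrite lee_fin.
  exact/disj_setPCl.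
rewrite integral0y_affine_sqr_gauss setCitvr.
rewrite integral_itv_bndo_bndc; last exact/measurable_EFinP/measurable_funTS.
(* The substitution rule expects an endpoint of the form [- r], hence 0 is written as [- 0]. *)
rewrite -{1}oppr0 ge0_integration_by_substitutionNy//; last first.
  exact: continuous_subspaceT.
under eq_integral.
  move=> x _; rewrite (_ : (f \o -%R) x = (- a * x + b) ^+ 2 * gauss_fun x);
    last first.
    by rewrite /f /= /gauss_fun sqrrN mulrN mulNr.
  over.
by rewrite integral0y_affine_sqr_gauss -EFinD; congr EFin; field.
Qed.

End gauss_moments.

(** * Second moments of one-dimensional normal laws *)

Section normal_second_moment.
Context {R : realType}.
Notation mu := (@lebesgue_measure R).

(** The Radon-Nikodym derivative and [normal_pdf] have the same integral over every measurable set,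
    so they agree almost everywhere. *)
Lemma ge0_integral_normal_prob (m s : R) (f : R -> \bar R) :
  measurable_fun setT f -> (forall x, 0 <= f x)%E ->
  (\int[normal_prob m s]_x f x = \int[mu]_x (f x * (normal_pdf m s x)%:E))%E.
Proof.
move=> mf f0; have dom := @normal_prob_dominates R m s.
have mpdf : measurable_fun [set: R] (fun x => (normal_pdf m s x)%:E).
  by apply/measurable_EFinP; exact: measurable_normal_pdf.
rewrite -(Radon_Nikodym_SigmaFinite.change_of_variables dom)//.
have iRN := Radon_Nikodym_SigmaFinite.f_integrable dom.
apply: ae_eq_integral => //.
- by apply: emeasurable_funM => //; exact: measurable_int iRN.
- exact: emeasurable_funM.
- apply: ae_eqe_mul2l; apply: integral_ae_eq => //.
  by move=> E _ mE; rewrite -Radon_Nikodym_SigmaFinite.f_integral.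
Qed.

Lemma normal_pdf_gauss (m s x : R) : 0 < s ->
  normal_pdf m s x =
  (Num.sqrt pi)^-1 * gauss_fun ((x - m) / (s * Num.sqrt 2)) / (s * Num.sqrt 2).
Proof.
move=> s0; rewrite normal_pdfE ?gt_eqF// /normal_peak /normal_fun /gauss_fun.
rewrite expr_div_n exprMn sqr_sqrtr// mulr_natr mulNr.
rewrite -mulr_natr -mulrA (mulrC pi) sqrtrM ?sqr_ge0// sqrtr_sqr gtr0_norm//.
rewrite sqrtrM// !invfM; ring.
Qed.

Lemma integral_normal_prob_sqr (m s c : R) : 0 < s ->
  (\int[normal_prob m s]_x ((x - c) ^+ 2)%:E = (s ^+ 2 + (m - c) ^+ 2)%:E)%E.
Proof.
move=> s0.
have mD (k : R) : measurable_fun [set: R] (fun x => (x - k) ^+ 2).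
  by apply: measurable_funX; exact: measurable_funB.
rewrite ge0_integral_normal_prob; first last.
- by move=> x; rewrite lee_fin sqr_ge0.
- exact/measurable_EFinP.
pose q := s * Num.sqrt 2; have q0 : 0 < q by rewrite mulr_gt0// sqrtr_gt0.
have qV0 : 0 < q^-1 by rewrite invr_gt0.
(* Substituting [t = (x - m) / q] gives [x - c = q t + (m - c)], and the factor [q^-1] of the
   density is the derivative of [F]. *)
pose G (t : R) : R := (Num.sqrt pi)^-1 * ((q * t + (m - c)) ^+ 2 * gauss_fun t).
pose F (x : R) := (x - m) / q.
have dF (x : R) : is_derive x 1 F q^-1.
  by apply: is_derive_eq; rewrite /GRing.scale /=; ring.
have F'E : F^`()%classic = cst q^-1.
  by apply/funext => x; rewrite derive1E; have [_] := dF x.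
have cA := @continuous_affine_sqr_gauss R q (m - c).
transitivity (\int[mu]_x (((G \o F) * F^`()%classic) x)%:E)%E.
  apply: eq_integral => x _; rewrite -EFinM F'E; congr EFin.
  rewrite normal_pdf_gauss// -/q /= /G /F fctE /=.
  by rewrite (mulrC q) divfK ?gt_eqF//; ring.
rewrite -increasing_ge0_integration_by_substitutionT.
- under eq_integral do rewrite EFinM.
  rewrite ge0_integralZl//; last 2 first.
  + by apply/measurable_EFinP; exact: continuous_measurable_fun.
  + by move=> x _; rewrite lee_fin mulr_ge0 ?sqr_ge0 ?expR_ge0.
  rewrite integralT_affine_sqr_gauss -EFinM; congr EFin.
  rewrite /q exprMn sqr_sqrtr//; field.
  by rewrite gt_eqF// sqrtr_gt0 pi_gt0.
- by move=> x y xy; rewrite /F ltr_pM2r// ltrD2r.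
- by rewrite F'E => ?; exact: cvg_cst.
- by rewrite F'E; exact: is_cvg_cst.
- by rewrite F'E; exact: is_cvg_cst.
- by move=> x; have [] := dF x.
- by apply/gt0_cvgMlNy => //; exact: cvg_addrr_Ny.
- by apply/gt0_cvgMly => //; exact: cvg_addrr.
- by move=> x; apply: cvgM; [exact: cvg_cst|exact: cA].
- by move=> x; apply: mulr_ge0; rewrite ?invr_ge0 ?sqrtr_ge0//
    mulr_ge0 ?sqr_ge0 ?expR_ge0.
Qed.

(* [normal_prob] lives on [measurableTypeR R], whose display is not the default
   one carried by [R]: hence the type of [Q]. *)
Lemma integral_normal_law1_sqr (m v c : R)
    (Q : {measure set (measurableTypeR R) -> \bar R}) : 0 <= v ->
  (forall B, measurable B -> Q B = normal_law1 m v B) ->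
  (\int[Q]_x ((x - c) ^+ 2)%:E = (v + (m - c) ^+ 2)%:E)%E.
Proof.
move=> v0; rewrite /normal_law1; have [-> QE|vN0 QE] := eqVneq v 0.
  transitivity (\int[@dirac _ (measurableTypeR R) m R]_x ((x - c) ^+ 2)%:E)%E.
    by apply: eq_measure_integral => A mA _; rewrite QE.
  rewrite integral_dirac//; last first.
    by apply/measurable_EFinP/measurable_funX; exact: measurable_funB.
  by rewrite diracT mul1e add0r.
transitivity (\int[normal_prob m (Num.sqrt v)]_x ((x - c) ^+ 2)%:E)%E.
  by apply: eq_measure_integral => A mA _; rewrite QE.
by rewrite integral_normal_prob_sqr ?sqr_sqrtr// sqrtr_gt0 lt_neqAle eq_sym vN0.
Qed.

End normal_second_moment.

(** * Coordinates of vectors and matrices *)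

Lemma norm2_sqr {R : realType} {D : nat} (x : 'cV[R]_D) :
  norm2 x ^+ 2 = \sum_(i < D) x i ord0 ^+ 2.
Proof. by rewrite sqr_sqrtr// sumr_ge0// => i _; rewrite sqr_ge0. Qed.

Lemma measurable_coord {d} {T : measurableType d} {m n : nat}
    (i : 'I_m) (j : 'I_n) :
  measurable_fun [set: 'M[T]_(m, n)] (fun A : 'M[T]_(m, n) => A i j).
Proof.
move=> _ B mB; rewrite setTI; apply: sub_sigma_algebra.
by exists (i, j) => //; exists B => //; rewrite setTI.
Qed.

(** Used to read off the variance of a coordinate, and to see that diagonal entries of a positive
    semi-definite matrix are nonnegative. *)
Lemma delta_form {R : realType} {D : nat} (S : 'M[R]_D) (i : 'I_D) :
  ((delta_mx i ord0 : 'cV[R]_D)^T *m S *m (delta_mx i ord0 : 'cV[R]_D))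
    ord0 ord0 = S i i.
Proof. by rewrite trmx_delta -rowE -colE !mxE. Qed.

Lemma delta_coord {R : realType} {D : nat} (x : 'cV[R]_D) (i : 'I_D) :
  ((delta_mx i ord0 : 'cV[R]_D)^T *m x) ord0 ord0 = x i ord0.
Proof. by rewrite trmx_delta -rowE !mxE. Qed.

(** * Integration against the joint law of an independent pair *)

Section independence.
Context {d d1 d2 : measure_display} {T : measurableType d}
  {T1 : measurableType d1} {T2 : measurableType d2} {R : realType}.
Variables (P : probability T R) (X : {RV P >-> T1}) (Y : {RV P >-> T2}).

(** Independence says that the joint law agrees with the product of the laws on rectangles, hence
    everywhere by uniqueness of the product measure; Tonelli then iterates the integral. *)
Lemma ge0_integral_independent (f : T1 * T2 -> \bar R) :
  independent_RV X Y -> measurable_fun setT f ->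
  (forall z, 0 <= f z)%E ->
  (\int[P]_w f (X w, Y w) =
   \int[distribution P X]_x \int[distribution P Y]_y f (x, y))%E.
Proof.
move=> indXY mf f0.
have mXY : measurable_fun [set: T] (fun w => (X w, Y w)).
  by apply/measurable_fun_pairP; split; exact: measurable_funPT.
pose XY : {RV P >-> (T1 * T2)%type} :=
  HB.pack (fun w => (X w, Y w)) (isMeasurableFun.Build _ _ _ _ _ mXY).
rewrite -(@fubini_tonelli1 _ _ _ _ _ (distribution P X) (distribution P Y))//.
transitivity (\int[distribution P XY]_z f z)%E.
  by rewrite ge0_integral_distribution.
apply: eq_measure_integral => A mA _.
symmetry; apply: product_measure_unique => // A1 A2 mA1 mA2.
Qed.

End independence.

(** Testing [is_normal_law] on the [i]-th basis vector shows that the [i]-th marginal is normal with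
    mean [mu i ord0] and variance [S i i]. *)
Lemma integral_normal_law_coord_sqr {R : realType} {D : nat} (mu : 'cV[R]_D)
    (S : 'M[R]_D) (Q : probability 'cV[R]_D R) (i : 'I_D) (c : R) :
  sym_psd S -> is_normal_law mu S Q ->
  (\int[Q]_x ((x i ord0 - c) ^+ 2)%:E =
   (S i i + (mu i ord0 - c) ^+ 2)%:E)%E.
Proof.
move=> [_ S0] QE; have mc := @measurable_coord _ R D 1 i ord0.
pose p : {mfun 'cV[R]_D >-> measurableTypeR R} :=
  HB.pack (fun x : 'cV[R]_D => x i ord0 : measurableTypeR R)
    (isMeasurableFun.Build _ _ _ (measurableTypeR R) _ mc).
transitivity (\int[pushforward Q p]_y ((y - c) ^+ 2)%:E)%E.
  rewrite ge0_integral_pushforward//.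
    by apply/measurable_EFinP/measurable_funX; exact: measurable_funB.
  by move=> y _; rewrite lee_fin sqr_ge0.
apply: integral_normal_law1_sqr.
  by rewrite -delta_form.
move=> B mB; rewrite -(delta_form S) -(delta_coord mu) -QE//.
by rewrite /pushforward; congr (Q _); apply/seteqP; split => x /=;
  rewrite delta_coord.
Qed.

Theorem proposition1 (R : realType) (d : measure_display)
    (T : measurableType d) (P : probability T R) (D : nat) (hD : (1 <= D)%N)
    (muX muY : 'cV[R]_D) (SX SY : 'M[R]_D)
    (hSX : sym_psd SX) (hSY : sym_psd SY)
    (X Y : {RV P >-> 'cV[R]_D})
    (hX : is_normal_law muX SX (distribution P X))
    (hY : is_normal_law muY SY (distribution P Y))
    (hXY : independent_RV X Y) :
  ('E_P[fun w : T => (norm2 (X w - Y w) ^+ 2)%R] =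
    (norm2 (muX - muY) ^+ 2 + \tr (SX + SY))%R%:E)%E.
Proof.
rewrite unlock.
under eq_integral do rewrite norm2_sqr -sumEFin.
have mX (i : 'I_D) : measurable_fun [set: T] (fun w => X w i ord0).
  by apply: (measurableT_comp (measurable_coord i ord0)).
have mY (i : 'I_D) : measurable_fun [set: T] (fun w => Y w i ord0).
  by apply: (measurableT_comp (measurable_coord i ord0)).
rewrite ge0_integral_sum//; last 2 first.
- move=> i; apply/measurable_EFinP/measurable_funX.
  under eq_fun do rewrite !mxE.
  exact: measurable_funB.
- by move=> i w _; rewrite lee_fin sqr_ge0.
rewrite norm2_sqr /mxtrace -big_split -sumEFin /=; apply: eq_bigr => i _.
(* The difference is reversed so that the inner integral, over the law of [Y], has the form
   [(y - c)^2] with [c = x i ord0]. *)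
pose f (z : 'cV[R]_D * 'cV[R]_D) := (((z.2 i ord0 - z.1 i ord0) ^+ 2)%:E : \bar R).
transitivity (\int[P]_w f (X w, Y w))%E.
  by apply: eq_integral => w _; rewrite /f /= !mxE -sqrrN opprB.
rewrite ge0_integral_independent//; first last.
- by move=> z; rewrite lee_fin sqr_ge0.
- apply/measurable_EFinP/measurable_funX; apply: measurable_funB.
    exact: (measurableT_comp (measurable_coord i ord0) measurable_snd).
  exact: (measurableT_comp (measurable_coord i ord0) measurable_fst).
under eq_integral.
  move=> x _; rewrite /f /= (integral_normal_law_coord_sqr _ _ hSY hY).
  (* Reversed again: the outer integral over the law of [X] now has [c = muY i ord0]. *)
  rewrite (_ : _ + _ = SY i i + (x i ord0 - muY i ord0) ^+ 2); last by ring.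
  rewrite EFinD.
  over.
rewrite ge0_integralD//=; last 3 first.
- by move=> x _; rewrite lee_fin -delta_form; case: hSY.
- by move=> x _; rewrite lee_fin sqr_ge0.
- apply/measurable_EFinP/measurable_funX; apply: measurable_funB => //.
  exact: measurable_coord.
rewrite integral_cst// [X in (_ * X)%E](_ : _ = 1%E); last exact: probability_setT.
rewrite mule1 (integral_normal_law_coord_sqr _ _ hSX hX).
by rewrite -EFinD; congr EFin; rewrite !mxE; ring.
Qed.
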